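(* Let $\mathbb{V}$ be a real Hilbert space, let $g\colon\mathbb{R}^m\to\mathbb{R}\cup\{\infty\}$ be a proper convex lower semi-continuous function, and let $f\colon\mathbb{V}\to\mathbb{R}\cup\{\infty\}$ be given by $f(\mathbf{x}) = g(A\mathbf{x}+\mathbf{b})$, where $\mathbf{b}\in\mathbb{R}^m$ and $A\colon\mathbb{V}\to\mathbb{R}^m$ is a linear transformation satisfying $A^\top A=\alpha\,\mathrm{Id}$ for some constant $\alpha>0$. Then for any $\mathbf{x}\in\mathbb{V}$, $$\mathrm{prox}_f(\mathbf{x}) = \alpha^{-1}A^\top\left(\mathrm{prox}_{\alpha g + \iota_{(\mathcal{R}(A)+\mathbf{b})}}(A\mathbf{x}+\mathbf{b})-\mathbf{b}\right),$$ where $\iota_{(\mathcal{R}(A)+\mathbf{b})}$ is the indicator function of the affine space $\mathcal{R}(A)+\mathbf{b}$ obtained by shifting the range space $\mathcal{R}(A)$ of $A$ by the vector $\mathbf{b}$.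
   Context: Norms are those induced by the inner products: $\mathbb{R}^m$ carries the standard Euclidean inner product, and $A^\top\colon\mathbb{R}^m\to\mathbb{V}$ denotes the adjoint of $A$. $\mathrm{Id}$ is the identity on $\mathbb{V}$ (so $A$ is injective and $\mathbb{V}$ is finite-dimensional). For a set $C$, the indicator function is $\iota_C(\mathbf{x})=0$ if $\mathbf{x}\in C$ and $\iota_C(\mathbf{x})=\infty$ otherwise. For a function $h\colon\mathbb{H}\to\mathbb{R}\cup\{\infty\}$ on a Hilbert space $\mathbb{H}$, the proximal operator is $\mathrm{prox}_h(\mathbf{x})=\operatorname{arg\,min}_{\mathbf{u}\in\mathbb{H}}\left\{h(\mathbf{u})+\tfrac12\|\mathbf{u}-\mathbf{x}\|^2\right\}$, i.e. the set of minimizers; it is a single point, with which it is identified, whenever $h$ is proper, convex and lower semi-continuous. (Should $f\equiv\infty$, both sides of the identity are read as sets of minimizers, with $\mathbf{z}\mapsto\alpha^{-1}A^\top(\mathbf{z}-\mathbf{b})$ applied elementwise.) *)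

(* Defs.v *)
(* MathComp-Analysis *)
From HB Require Import structures.
From mathcomp Require Import all_boot all_order all_algebra.
From mathcomp Require Import all_classical all_reals all_analysis.
Set Implicit Arguments.
Unset Strict Implicit.
Unset Printing Implicit Defensive.
Import Order.TTheory GRing.Theory Num.Theory numFieldNormedType.Exports.
Local Open Scope classical_set_scope.
Local Open Scope ring_scope.

Section EuclideanDot.
Variables (R : realType) (m : nat).

Definition edot (x y : 'cV[R]_m) : R := \sum_(i < m) x i 0 * y i 0.

Let edot_bilinear :
  bilinear_for (GRing.Scale.Law.clone _ _ *%R _)
               (GRing.Scale.Law.clone _ _ *%R _) edot.
Proof.
split=> [y|x] a u v; rewrite /edot /= mulr_sumr -big_split /=.
- by apply: eq_bigr => i _; rewrite !mxE mulrDl mulrA.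
- by apply: eq_bigr => i _; rewrite !mxE mulrDr mulrCA.
Qed.

HB.instance Definition _ := bilinear_isBilinear.Build R 'cV[R]_m 'cV[R]_m R
  (GRing.Scale.Law.clone _ _ *%R _)
  (GRing.Scale.Law.clone _ _ (idfun \; *%R) _) edot edot_bilinear.

Let edot_hermitian x y : edot x y = (-1) ^+ false * idfun (edot y x).
Proof. by rewrite expr0 mul1r; apply: eq_bigr => i _; rewrite mulrC. Qed.

HB.instance Definition _ :=
  isHermitianSesquilinear.Build R 'cV[R]_m false idfun edot edot_hermitian.

Let edot_gt0 x : x != 0 -> 0 < edot x x.
Proof.
move=> x0; have sq_ge0 i : true -> 0 <= x i 0 * x i 0.
  by move=> _; rewrite -expr2 sqr_ge0.
rewrite lt_neqAle sumr_ge0 // andbT eq_sym.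
apply: contra x0; rewrite psumr_eq0 // => /allP x0.
apply/eqP/colP => i; rewrite mxE.
by have := x0 i (mem_index_enum _); rewrite mulf_eq0 orbb => /eqP.
Qed.

HB.instance Definition _ := isDotProduct.Build R 'cV[R]_m edot edot_gt0.

End EuclideanDot.

(* The Euclidean space R^m is ['cV[R]_m] with this inner product. The library
   norm of ['cV[R]_m] is the sup norm and is never used; only its topology is
   (the usual one of R^m). *)
Definition euclidean (R : realType) (m : nat) : {dot 'cV[R]_m for idfun} :=
  @edot R m.

Definition ipnorm (R : realType) (E : lmodType R) (ip : {dot E for idfun})
  (x : E) : R := Num.sqrt (ip x x).

(* A real Hilbert space: a Banach space together with an inner product that
   induces its norm. *)
Definition is_hilbert (R : realType) (V : completeNormedModType R)
  (ip : {dot V for idfun}) : Prop := forall x : V, `|x| = ipnorm ip x.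

Definition is_adjoint (R : realType) (E F : lmodType R)
  (ipE : {dot E for idfun}) (ipF : {dot F for idfun})
  (A : E -> F) (At : F -> E) : Prop :=
  forall (x : E) (y : F), ipF (A x) y = ipE x (At y).

Section ExtendedValued.
Variables (R : realType) (T : Type) (E : lmodType R).
Local Open Scope ereal_scope.

Definition above_ninfty (h : T -> \bar R) : Prop := forall x, h x != -oo.

Definition proper_efun (h : T -> \bar R) : Prop :=
  above_ninfty h /\ exists x, h x < +oo.

Definition convex_efun (h : E -> \bar R) : Prop :=
  forall (x y : E) (t : R), (0 < t < 1)%R ->
    h (t *: x + (1 - t) *: y)%R <= t%:E * h x + (1 - t)%:E * h y.

Definition eindic (C : set T) (x : T) : \bar R :=
  if x \in C then 0 else +oo.

(* If h is identically +oo, every point is a minimizer. *)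
Definition prox (ip : {dot E for idfun}) (h : E -> \bar R) (x : E) : set E :=
  let obj u := h u + (2^-1 * ipnorm ip (u - x) ^+ 2)%:E in
  [set u | forall v, obj u <= obj v].

End ExtendedValued.

(* Main.v *)
(* Since |A v|^2 = <v, A^T A v> = alpha |v|^2, the objective defining the
   right-hand prox at z = A v + b is alpha times the objective defining prox_f
   at v; off the affine space R(A) + b it is +oo. Hence if z is a minimizer, so
   is alpha^-1 A^T (z - b), even when z lies off R(A) + b, in which case both
   objectives are identically +oo. *)
Require Import Defs.
From HB Require Import structures.
From mathcomp Require Import all_boot all_order all_algebra.
From mathcomp Require Import all_classical all_reals all_analysis.
Set Implicit Arguments.
Unset Strict Implicit.
Import Order.TTheory GRing.Theory Num.Theory numFieldNormedType.Exports.
Local Open Scope classical_set_scope.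
Local Open Scope ring_scope.

Lemma ipnorm_sqr (R : realType) (E : lmodType R) (ip : {dot E for idfun})
  (x : E) : ipnorm ip x ^+ 2 = ip x x.
Proof.
rewrite /ipnorm sqr_sqrtr//.
have [->|x0] := eqVneq x 0; first by rewrite linear0l.
exact/ltW/neq0_dnorm_gt0.
Qed.

Lemma ipnorm_sqr_adjoint (R : realType) (E F : lmodType R)
  (ipE : {dot E for idfun}) (ipF : {dot F for idfun})
  (A : E -> F) (At : F -> E) (alpha : R) (hAt : is_adjoint ipE ipF A At)
  (AtA : forall x, At (A x) = alpha *: x) (x : E) :
  ipnorm ipF (A x) ^+ 2 = alpha * ipnorm ipE x ^+ 2.
Proof. by rewrite !ipnorm_sqr hAt AtA linearZr. Qed.

Section ProxAffine.
Variables (R : realType) (E F : lmodType R).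
Variables (ipE : {dot E for idfun}) (ipF : {dot F for idfun}).
Variables (g : F -> \bar R) (A : {linear E -> F}) (b : F) (At : F -> E).
Variables (alpha : R) (x : E).
Hypothesis g_ninfty : above_ninfty g.
Hypothesis hAt : is_adjoint ipE ipF A At.
Hypothesis alpha_gt0 : 0 < alpha.
Hypothesis AtA : forall x, At (A x) = alpha *: x.

Let C : set F := [set y + b | y in range A].
Let objE u : \bar R := (g (A u + b) + (2^-1 * ipnorm ipE (u - x) ^+ 2)%:E)%E.
Let objF z : \bar R := (alpha%:E * g z + eindic R C z +
  (2^-1 * ipnorm ipF (z - (A x + b)) ^+ 2)%:E)%E.

(** On the affine space the indicator vanishes and the two shifts by [b] cancel, leaving [A (v - x)]
    inside the norm. *)
Let objF_range v : objF (A v + b) = (alpha%:E * objE v)%E.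
Proof.
have Cv : A v + b \in C by apply/mem_set; exists (A v) => //; exists v.
rewrite /objF /objE /eindic Cv adde0 opprD addrACA subrr addr0 -raddfB.
rewrite (ipnorm_sqr_adjoint hAt AtA).
(* The quadratic term is finite, so [alpha] distributes over the sum even where [g] is [+oo]. *)
by rewrite muleDr// ?fin_num_adde_defl// -EFinM mulrCA.
Qed.

Let preimageK v : alpha^-1 *: At (A v + b - b) = v.
Proof. by rewrite addrK AtA scalerA mulVf ?gt_eqF// scale1r. Qed.

(** Stated for every [z], so that neither inclusion below has to ask whether [z] lies in [C]: on [C]
    it is an equality, off [C] the right side is [+oo]. *)
Let objF_ge z : (alpha%:E * objE (alpha^-1 *: At (z - b)) <= objF z)%E.
Proof.
have [/set_mem[_ [v _ <-] <-]|zC] := boolP (z \in C).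
  by rewrite preimageK objF_range.
rewrite /objF /eindic (negbTE zC) addey ?addye ?leey//.
(* [alpha * g z] is not [-oo], so adding the [+oo] of the indicator really gives [+oo]. *)
by have := g_ninfty z; case: (g z) => // _; rewrite gt0_muley ?lte_fin.
Qed.

Lemma prox_comp_affine :
  prox ipE (fun u => g (A u + b)) x =
  [set alpha^-1 *: At (z - b) |
    z in prox ipF (fun z => alpha%:E * g z + eindic R C z)%E (A x + b)].
Proof.
have alpha0 : (0 < alpha%:E)%E by rewrite lte_fin.
apply/seteqP; split=> [u umin|_ [z zmin <-] v].
- exists (A u + b); last exact: preimageK.
  move=> z; rewrite -/(objF _) -/(objF z) objF_range.
  (* Minimality of [u] is tested against the pullback [alpha^-1 *: At (z - b)] of the competitor
     [z]. *)
  by apply: (le_trans _ (objF_ge z)); rewrite lee_pmul2l//; exact: umin.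
(* Conversely, scaling by [alpha] turns the competitor [v] into the competitor [A v + b] of [z]. *)
- rewrite -(@lee_pmul2l _ alpha%:E)// -/(objE _) -/(objE v) -(objF_range v).
  exact: le_trans (objF_ge z) (zmin (A v + b)).
Qed.

End ProxAffine.

Theorem lemma2 (R : realType) (V : completeNormedModType R)
  (ip : {dot V for idfun}) (hV : is_hilbert ip)
  (m : nat) (g : 'cV[R]_m -> \bar R)
  (g_proper : proper_efun g) (g_convex : convex_efun g)
  (g_lsc : lower_semicontinuous g)
  (A : {linear V -> 'cV[R]_m}) (b : 'cV[R]_m)
  (f : V -> \bar R) (fE : forall x, f x = g (A x + b))
  (At : 'cV[R]_m -> V) (hAt : is_adjoint ip (euclidean R m) A At)
  (alpha : R) (alpha_gt0 : 0 < alpha)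
  (AtA : forall x, At (A x) = alpha *: x) (x : V) :
  prox ip f x =
  [set alpha^-1 *: At (z - b) |
    z in prox (euclidean R m)
           (fun z => (alpha%:E * g z + eindic R [set y + b | y in range A]%R z)%E)
           (A x + b)].
Proof.
have -> : f = fun u => g (A u + b) by apply/funext.
exact: (prox_comp_affine b x g_proper.1 hAt).
Qed.
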